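(* Let $M$ be an oriented one-cusped hyperbolic 3-manifold, $\alpha:\pi_1(M)\to\mathbb Z$ an epimorphism and $\mu$ a peripheral curve with $\alpha(\mu)=1$. Let $\mathcal T$ be an ideal triangulation of $M$ with $N$ tetrahedra and $\overline{\mathcal T}$ an ideal triangulation with $N+1$ tetrahedra obtained from $\mathcal T$ by a 2--3 Pachner move. Let $\mathbf A(t),\mathbf B(t)$ and $\overline{\mathbf A}(t),\overline{\mathbf B}(t)$ be the twisted Neumann--Zagier matrices of $\mathcal T$ and $\overline{\mathcal T}$, with the choices of quad types, orderings and lifts described in the context, and write in columns $\mathbf A(t)=(a_1,a_2,a_i)$, $\mathbf B(t)=(b_1,b_2,b_i)$, where $a_i$ stands for $(a_3,a_4,\dots,a_N)$ and $b_i$ for $(b_3,\dots,b_N)$. Then there exists a lower triangular $(N+1)\times(N+1)$ matrix $P$ with entries in $\mathbb Z[t^{\pm1}]$ and with $1$'s on the diagonal such that $$ P\,\overline{\mathbf A}(t)=\begin{pmatrix}-1&-1&-1&0\\ b_1+b_2&a_1&a_2&a_i\end{pmatrix},\qquad P\,\overline{\mathbf B}(t)=\begin{pmatrix}-1&-1&-1&0\\ 0&a_2+b_1&a_1+b_2&b_i\end{pmatrix}. $$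
   Context: $M$ is an oriented (complete, finite volume) hyperbolic 3-manifold with one torus cusp. An ideal triangulation of $M$ with $N$ tetrahedra $\Delta_j$ has exactly $N$ edges $e_i$. A quad type of a tetrahedron is a pair of opposite edges. Fixing a quad type of each oriented tetrahedron $\Delta_j$, the pairs of opposite edges of $\Delta_j$ are labelled by $z_j,z_j',z_j''$ (the chosen quad type gets $z_j$; seen from each ideal vertex the labels occur in the counterclockwise cyclic order $z_j,z'_j,z''_j$). The symbol $\square$ stands for no prime, one prime or two primes. A peripheral curve is an oriented homotopically non-trivial simple closed curve in the peripheral torus of $M$. $\widetilde M$ is the cover of $M$ corresponding to $\alpha^{-1}(0)$, with lifted ideal triangulation $\widetilde{\mathcal T}$; its deck group $\mathbb Z$ is generated by the action of $\mu$. Choose lifts $\widetilde e_i,\widetilde\Delta_j$ of $e_i,\Delta_j$ to $\widetilde{\mathcal T}$. For $k\in\mathbb Z$, $\mathbf G_k^\square$ is the integer matrix whose $(i,j)$-entry is the number of edges of $\mu^k\cdot\widetilde\Delta_j$ labelled $z_j^\square$ that are incident (identified) to $\widetilde e_i$. The twisted gluing equation matrices are $\mathbf G^\square(t)=\sum_{k}\mathbf G_k^\square t^k$ and the twisted Neumann--Zagier matrices are $\mathbf A(t)=\mathbf G(t)-\mathbf G'(t)$, $\mathbf B(t)=\mathbf G''(t)-\mathbf G'(t)$ (rows indexed by edges, columns by tetrahedra); similarly for $\overline{\mathcal T}$. 2--3 Pachner move: two distinct tetrahedra $\Delta_\alpha,\Delta_\beta$ of $\mathcal T$ with a common face form a bipyramid,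 which is re-divided into three tetrahedra $\Delta_a,\Delta_b,\Delta_c$ sharing a new edge $e_0$ joining the two apexes; all other tetrahedra and edges are unchanged. Quad types: those of the common tetrahedra agree in $\mathcal T$ and $\overline{\mathcal T}$. In the bipyramid they are chosen so that: the new edge $e_0$ is labelled $z'_a,z'_b,z'_c$ in $\Delta_a,\Delta_b,\Delta_c$; the three edges of the common face are labelled $z_\alpha,z_\beta$ (in $\Delta_\alpha,\Delta_\beta$) and $z_a'$ (in $\Delta_a$), respectively $z'_\alpha,z''_\beta$ and $z_b'$, respectively $z''_\alpha,z'_\beta$ and $z_c'$; and the six remaining edges of the bipyramid have labels in $\Delta_\alpha$ or $\Delta_\beta$ on the left, corresponding to the two labels in the new tetrahedra on the right: $z_\alpha\leftrightarrow z_b,z_c''$; $z'_\alpha\leftrightarrow z_a'',z_c$; $z''_\alpha\leftrightarrow z_a,z_b''$; $z_\beta\leftrightarrow z_b'',z_c$; $z'_\beta\leftrightarrow z''_a,z_b$; $z''_\beta\leftrightarrow z_a,z_c''$. Orderings: in $\mathcal T$, $\Delta_\alpha$ is first and $\Delta_\beta$ second; in $\overline{\mathcal T}$ the tetrahedra are ordered $\Delta_a,\Delta_b,\Delta_c$ followed by the third to $N$-th tetrahedra of $\mathcal T$, and the edges are ordered $e_0$ followed by the edges of $\mathcal T$ in their order. Lifts: the common edges and common tetrahedra have the same lifts for both triangulations; the lifts of $\Delta_\alpha,\Delta_\beta,\Delta_a,\Delta_b,\Delta_c,e_0$ are chosen so that $\widetilde\Delta_\alpha\cup\widetilde\Delta_\beta$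 and $\widetilde\Delta_a\cup\widetilde\Delta_b\cup\widetilde\Delta_c$ are the same bipyramid in $\widetilde M$, containing $\widetilde e_0$. *)

(* Defs.v *)
(* MathComp / MathComp-Analysis. *)
From HB Require Import structures.
From Stdlib Require Import Relation_Operators.
From mathcomp Require Import all_boot all_order all_algebra all_fingroup.
From mathcomp Require Import all_classical all_reals all_analysis.
Set Implicit Arguments.
Unset Strict Implicit.
Unset Printing Implicit Defensive.
Import Order.TTheory GRing.Theory Num.Theory.
Import numFieldNormedType.Exports.
Local Open Scope classical_set_scope.
Local Open Scope ring_scope.

(* Hyperbolic 3-space is the upper sheet of the hyperboloid in R^{1,3}.  A
   complete oriented hyperbolic 3-manifold M is H^3 / Gam, where Gam is a
   discrete group of orientation preserving isometries acting freely, and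
   pi_1(M) is Gam.  A subset of M, or of a cover H^3 / K of M, is represented by
   its preimage in H^3. *)

Definition lorentz (R : realType) (x y : 'cV[R]_4) : R :=
  - (x 0 0 * y 0 0) + \sum_(i < 3) x (lift ord0 i) 0 * y (lift ord0 i) 0.

Definition hyp3 (R : realType) : set 'cV[R]_4 :=
  [set x | lorentz x x = -1 /\ 0 < x 0 0].

Definition oriented_isometry (R : realType) (g : 'M[R]_4) : Prop :=
  [/\ forall x y, lorentz (g *m x) (g *m y) = lorentz x y,
      forall x, hyp3 x -> hyp3 (g *m x)
    & \det g = 1].

Record hyperbolic_group (R : realType) (Gam : set 'M[R]_4) : Prop := {
  hyp_isometry : forall g, Gam g -> oriented_isometry g ;
  hyp_one : Gam 1 ;
  hyp_mul : forall g h, Gam g -> Gam h -> Gam (g * h) ;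
  hyp_inv : forall g, Gam g -> Gam g^-1 ;
  hyp_discrete : \forall g \near (1 : 'M[R]_4), Gam g -> g = 1 ;
  hyp_free : forall g x, Gam g -> hyp3 x -> g *m x = x -> g = 1 }.

(* H^3 is the graph of sqrt (1 + |p|^2) over R^3; its volume form is
   dp / sqrt (1 + |p|^2). *)
Definition hyp_height (R : realType) (p : R * R * R) : R :=
  Num.sqrt (1 + p.1.1 ^+ 2 + p.1.2 ^+ 2 + p.2 ^+ 2).

Definition hyp_point (R : realType) (p : R * R * R) : 'cV[R]_4 :=
  \col_(i < 4) nth 0 [:: hyp_height p; p.1.1; p.1.2; p.2] i.

Definition hyp_volume (R : realType)
    (D : set (measurableTypeR R * measurableTypeR R * measurableTypeR R)) :
    \bar R :=
  (\int[(@lebesgue_measure R \x @lebesgue_measure R) \x @lebesgue_measure R]_(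
      p in D) ((hyp_height p)^-1)%:E)%E.

Definition finite_covolume (R : realType) (Gam : set 'M[R]_4) : Prop :=
  exists D : set (measurableTypeR R * measurableTypeR R * measurableTypeR R),
    [/\ measurable D,
        forall x, hyp3 x ->
          exists g p, [/\ Gam g, D p & x = g *m hyp_point p]
      & (hyp_volume D < +oo)%E].

(* Points of the sphere at infinity are rays of the future light cone.  An
   element of a discrete group acting freely that fixes a light-like vector
   (not only its ray) is trivial or parabolic. *)
Definition lightlike (R : realType) (v : 'cV[R]_4) : Prop :=
  lorentz v v = 0 /\ 0 < v 0 0.

Definition parabolic_point (R : realType) (Gam : set 'M[R]_4) (v : 'cV[R]_4) :=
  lightlike v /\ exists g, [/\ Gam g, g <> 1 & g *m v = v].

(* Cusps of M are Gam-orbits of parabolic fixed points.  In finite volume the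
   cross-section of a cusp of an oriented M is automatically a torus. *)
Definition one_cusp (R : realType) (Gam : set 'M[R]_4) : Prop :=
  (exists v, parabolic_point Gam v) /\
  forall v w, parabolic_point Gam v -> parabolic_point Gam w ->
    exists g c, [/\ Gam g, 0 < c & w = c *: (g *m v)].

Record one_cusped_hyperbolic (R : realType) (Gam : set 'M[R]_4) : Prop := {
  och_group : hyperbolic_group Gam ;
  och_volume : finite_covolume Gam ;
  och_cusp : one_cusp Gam }.

Definition horoball (R : realType) (v : 'cV[R]_4) : set 'cV[R]_4 :=
  [set x | hyp3 x /\ -1 <= lorentz x v].

Definition horosphere (R : realType) (v : 'cV[R]_4) : set 'cV[R]_4 :=
  [set x | hyp3 x /\ lorentz x v = -1].

(* When the horoball at v embeds modulo the stabilizer of v, the image of the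
   horosphere in M is a peripheral torus. *)
Definition embedded_cusp (R : realType) (Gam : set 'M[R]_4) (v : 'cV[R]_4) :=
  parabolic_point Gam v /\
  forall g x, Gam g -> horoball v x -> horoball v (g *m x) -> g *m v = v.

(* mu is the class of an oriented closed curve in a peripheral torus, given by a
   lift c : [0, 1] -> H^3 from c 0 to mu *m c 0; the curve is simple, and
   homotopically non-trivial. *)
Definition peripheral_curve (R : realType) (Gam : set 'M[R]_4) (mu : 'M[R]_4) :=
  exists (v : 'cV[R]_4) (c : R -> 'cV[R]_4),
    [/\ embedded_cusp Gam v,
        {within `[0, 1], continuous c} /\
          (forall s, 0 <= s <= 1 -> horosphere v (c s)),
        Gam mu /\ c 1 = mu *m c 0,
        forall s t g, 0 <= s < 1 -> 0 <= t < 1 -> Gam g ->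
          c t = g *m c s -> s = t
      & mu <> 1].

Definition epimorphism (R : realType) (Gam : set 'M[R]_4)
    (al : 'M[R]_4 -> int) : Prop :=
  (forall g h, Gam g -> Gam h -> al (g * h) = al g + al h) /\
  (forall k, exists2 g, Gam g & al g = k).

(* The group of the cover of M corresponding to the kernel of al. *)
Definition cover_group (R : realType) (Gam : set 'M[R]_4)
    (al : 'M[R]_4 -> int) : set 'M[R]_4 :=
  [set g | Gam g /\ al g = 0].

(* The standard 3-simplex minus its vertices, in barycentric coordinates. *)
Definition ideal_simplex (R : realType) : set 'rV[R]_4 :=
  [set x | (forall i, 0 <= x 0 i < 1) /\ \sum_i x 0 i = 1].

Definition simplex_edge (R : realType) (s : {set 'I_4}) : set 'rV[R]_4 :=
  [set x | ideal_simplex x /\ forall i, i \notin s -> x 0 i = 0].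

(* glue j f = (k, s): the face of the j-th tetrahedron opposite to its vertex f
   is glued affinely to a face of the k-th one, vertex i going to vertex s i.
   Odd permutations are the orientation reversing face pairings, for which the
   orientations of the tetrahedra given by the orders of their vertices
   are coherent. *)
Definition face_pairing (N : nat) (glue : 'I_N -> 'I_4 -> 'I_N * 'S_4) : Prop :=
  forall j f k s, glue j f = (k, s) ->
    [/\ glue k (s f) = (j, (s^-1)%g), (k, s f) != (j, f) & odd_perm s].

Definition glue_step (R : realType) (N : nat)
    (glue : 'I_N -> 'I_4 -> 'I_N * 'S_4) (p q : 'I_N * 'rV[R]_4) : Prop :=
  exists f s, [/\ p.2 0 f = 0, glue p.1 f = (q.1, s)
                & forall i, q.2 0 (s i) = p.2 0 i].

Definition glued (R : realType) (N : nat)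
    (glue : 'I_N -> 'I_4 -> 'I_N * 'S_4) : 'I_N * 'rV[R]_4 ->
    'I_N * 'rV[R]_4 -> Prop :=
  clos_refl_sym_trans _ (@glue_step R N glue).

(* An ideal triangulation of M = H^3 / Gam is a homeomorphism onto M from the
   quotient of N ideal tetrahedra by coherently oriented face pairings.  It is
   given by lifts tet j of the characteristic maps of the tetrahedra to H^3.
   M gets the orientation carried by the tetrahedra, which can be either one of
   its two orientations. *)
Definition ideal_triangulation (R : realType) (Gam : set 'M[R]_4) (N : nat)
    (tet : 'I_N -> 'rV[R]_4 -> 'cV[R]_4) : Prop :=
  exists glue : 'I_N -> 'I_4 -> 'I_N * 'S_4,
    face_pairing glue /\
    [/\ forall j, {within @ideal_simplex R, continuous (tet j)} /\
          (forall x, ideal_simplex x -> hyp3 (tet j x)),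
        forall z, hyp3 z ->
          exists g j x, [/\ Gam g, ideal_simplex x & z = g *m tet j x],
        forall j x k y, ideal_simplex x -> ideal_simplex y ->
          (exists2 g, Gam g & tet k y = g *m tet j x) <->
          glued glue (j, x) (k, y)
      & forall U : set 'cV[R]_4, U `<=` @hyp3 R ->
          (forall g x, Gam g -> U x -> U (g *m x)) ->
          (forall j, exists2 O : set 'rV[R]_4, open O &
             @ideal_simplex R `&` tet j @^-1` U = @ideal_simplex R `&` O) ->
          exists2 O : set 'cV[R]_4, open O & U = @hyp3 R `&` O].

(* An ideal triangulation with the choices needed to define its twisted
   Neumann-Zagier matrices: the lift of the j-th tetrahedron to the cover
   H^3 / K is the image of nz_tet j, nz_edge i is the lift of the i-th edge, and
   nz_quad is the choice of quad types (see quad_edges). *)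
Record nz_data (R : realType) (N : nat) := NZData {
  nz_tet : 'I_N -> 'rV[R]_4 -> 'cV[R]_4 ;
  nz_quad : 'I_N -> 'I_3 ;
  nz_edge : 'I_N -> set 'cV[R]_4 }.

(* The edge s of the translate by g of the tetrahedron tet, in H^3 / K. *)
Definition edge_in (R : realType) (K : set 'M[R]_4) (g : 'M[R]_4)
    (tet : 'rV[R]_4 -> 'cV[R]_4) (s : {set 'I_4}) : set 'cV[R]_4 :=
  [set z | exists h x, [/\ K h, simplex_edge s x & z = h *m (g *m tet x)]].

(* The last two fields say that the edges nz_edge i of the triangulation of
   H^3 / K contain exactly one lift of each edge of M. *)
Record nz_valid (R : realType) (Gam : set 'M[R]_4) (al : 'M[R]_4 -> int)
    (N : nat) (T : nz_data R N) : Prop := {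
  nz_triangulation : ideal_triangulation Gam (nz_tet T) ;
  nz_edge_lift : forall i, exists g j (s : {set 'I_4}),
    [/\ Gam g, #|s| = 2%N
      & nz_edge T i = edge_in (cover_group Gam al) g (nz_tet T j) s] ;
  nz_edge_unique : forall j (s : {set 'I_4}), #|s| = 2%N ->
    exists! i, exists2 g, Gam g &
      nz_edge T i = edge_in (cover_group Gam al) g (nz_tet T j) s }.

(* The quad types of an oriented tetrahedron are numbered modulo 3: the type q
   is the pair of opposite edges {0, q+1}, {0, q+1}^c.  With the orientation
   for which the vertices 1, 2, 3 are in counterclockwise order seen from the
   vertex 0, the types q, q+1, q+2 occur in counterclockwise order seen
   from each vertex. *)
Definition quad_edges (q : 'I_3) : {set {set 'I_4}} :=
  [set [set ord0; lift ord0 q]; ~: [set ord0; lift ord0 q]]%SET.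

(* The edges labelled z, z', z'' (p = 0, 1, 2) when q is the chosen type. *)
Definition labelled (q p : 'I_3) : {set {set 'I_4}} := quad_edges (q + p).

Definition gluing_coef (R : realType) (Gam : set 'M[R]_4)
    (al : 'M[R]_4 -> int) (mu : 'M[R]_4) (N : nat) (T : nz_data R N)
    (p : 'I_3) (k : int) (i j : 'I_N) : nat :=
  #|[set s in labelled (nz_quad T j) p |
      `[< edge_in (cover_group Gam al) (mu ^ k) (nz_tet T j) s = nz_edge T i >]
    ]%SET|.

(* Z[t, t^-1] as a subring of Q(t) = Frac Z[t]. *)
Notation Qt := {fraction {poly int}}.

Definition laurent_t : Qt := tofrac 'X.

Definition is_laurent (f : Qt) : Prop :=
  exists (p : {poly int}) (m : nat), f = tofrac p / laurent_t ^+ m.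

(* The sum over all k is the finite-support sum. *)
Definition twisted_gluing (R : realType) (Gam : set 'M[R]_4)
    (al : 'M[R]_4 -> int) (mu : 'M[R]_4) (N : nat) (T : nz_data R N)
    (p : 'I_3) : 'M[Qt]_N :=
  \matrix_(i, j)
    \sum_(k \in [set: int]) (gluing_coef Gam al mu T p k i j)%:R * laurent_t ^ k.

Definition twisted_A (R : realType) (Gam : set 'M[R]_4)
    (al : 'M[R]_4 -> int) (mu : 'M[R]_4) (N : nat) (T : nz_data R N) :
    'M[Qt]_N :=
  twisted_gluing Gam al mu T 0 - twisted_gluing Gam al mu T 1.

Definition twisted_B (R : realType) (Gam : set 'M[R]_4)
    (al : 'M[R]_4 -> int) (mu : 'M[R]_4) (N : nat) (T : nz_data R N) :
    'M[Qt]_N :=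
  twisted_gluing Gam al mu T 2 - twisted_gluing Gam al mu T 1.

(* A bipyramid with apexes n, s; the segment from n to s crosses the common face
   v1 v2 v3 at its barycenter. *)
Inductive bip_vertex := bip_n | bip_s | bip_v1 | bip_v2 | bip_v3.

Definition bip_pos (R : realType) (u : bip_vertex) : 'rV[R]_3 :=
  match u with
  | bip_n => 0
  | bip_s => const_mx (2 / 3)
  | bip_v1 => delta_mx 0 0
  | bip_v2 => delta_mx 0 1
  | bip_v3 => delta_mx 0 2
  end.

(* The tetrahedron tet is the piece of the bipyramid Phi spanned by all the
   vertices but omit, vertex i of tet being the vertex nu i. *)
Definition bip_piece (R : realType) (Phi : 'rV[R]_3 -> 'cV[R]_4)
    (tet : 'rV[R]_4 -> 'cV[R]_4) (nu : 'I_4 -> bip_vertex) (omit : bip_vertex) :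
    Prop :=
  [/\ injective nu, forall i, nu i <> omit
    & forall x, ideal_simplex x ->
        tet x = Phi (\sum_i x 0 i *: bip_pos R (nu i))].

Definition bip_label (nu : 'I_4 -> bip_vertex) (q p : 'I_3)
    (u v : bip_vertex) : Prop :=
  exists i j, [/\ nu i = u, nu j = v & [set i; j]%SET \in labelled q p].

(* In T, alpha = 0 and beta = 1; in T', a = 0, b = 1 and c = 2, and the new edge
   has index 0.  The map Phi is the lift to H^3 of the common bipyramid. *)
Record pachner23 (R : realType) (Gam : set 'M[R]_4) (al : 'M[R]_4 -> int)
    (n : nat) (T : nz_data R (2 + n)) (T' : nz_data R (3 + n)) : Prop := {
  p23_common_tet : forall (j : 'I_n) x, ideal_simplex x ->
    nz_tet T' (rshift 3 j) x = nz_tet T (rshift 2 j) x ;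
  p23_common_quad : forall j : 'I_n,
    nz_quad T' (rshift 3 j) = nz_quad T (rshift 2 j) ;
  p23_common_edge : forall i : 'I_(2 + n),
    nz_edge T' (lift ord0 i) = nz_edge T i ;
  p23_bipyramid : exists (Phi : 'rV[R]_3 -> 'cV[R]_4)
      (nual nube nua nub nuc : 'I_4 -> bip_vertex),
    let Lal := bip_label nual (nz_quad T 0) in
    let Lbe := bip_label nube (nz_quad T 1) in
    let La := bip_label nua (nz_quad T' 0) in
    let Lb := bip_label nub (nz_quad T' 1) in
    let Lc := bip_label nuc (nz_quad T' 2) in
    [/\ [/\ bip_piece Phi (nz_tet T 0) nual bip_s,
            bip_piece Phi (nz_tet T 1) nube bip_n,
            bip_piece Phi (nz_tet T' 0) nua bip_v1,
            bip_piece Phi (nz_tet T' 1) nub bip_v2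
          & bip_piece Phi (nz_tet T' 2) nuc bip_v3],
        forall i j, nua i = bip_n -> nua j = bip_s ->
          nz_edge T' 0 =
            edge_in (cover_group Gam al) 1 (nz_tet T' 0) [set i; j]%SET,
        [/\ La 1 bip_n bip_s, Lb 1 bip_n bip_s & Lc 1 bip_n bip_s],
        [/\ [/\ Lal 0 bip_v2 bip_v3, Lbe 0 bip_v2 bip_v3 & La 1 bip_v2 bip_v3],
            [/\ Lal 1 bip_v1 bip_v3, Lbe 2 bip_v1 bip_v3 & Lb 1 bip_v1 bip_v3]
          & [/\ Lal 2 bip_v1 bip_v2, Lbe 1 bip_v1 bip_v2 & Lc 1 bip_v1 bip_v2]]
      & [/\ [/\ Lal 0 bip_n bip_v1, Lb 0 bip_n bip_v1 & Lc 2 bip_n bip_v1],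
            [/\ Lal 1 bip_n bip_v2, La 2 bip_n bip_v2 & Lc 0 bip_n bip_v2]
          & [/\ Lal 2 bip_n bip_v3, La 0 bip_n bip_v3 & Lb 2 bip_n bip_v3]] /\
        [/\ [/\ Lbe 0 bip_s bip_v1, Lb 2 bip_s bip_v1 & Lc 0 bip_s bip_v1],
            [/\ Lbe 1 bip_s bip_v3, La 2 bip_s bip_v3 & Lb 0 bip_s bip_v3]
          & [/\ Lbe 2 bip_s bip_v2, La 0 bip_s bip_v2 & Lc 2 bip_s bip_v2]]] }.

(* Main.v *)
Require Import Defs.
From mathcomp Require Import all_boot all_order all_algebra all_fingroup.
From mathcomp Require Import all_classical all_reals all_analysis.
From mathcomp Require Import ring.
Set Implicit Arguments.
Unset Strict Implicit.
Unset Printing Implicit Defensive.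
Import Order.TTheory GRing.Theory Num.Theory.
Local Open Scope ring_scope.

(* An edge of the bipyramid is a segment between two of its five vertices, so
   its translates in the infinite cyclic cover do not depend on the tetrahedron
   in which it is seen.  Counting the translates of a segment equal to a given
   lifted edge yields a Laurent polynomial, and every entry of a column of the
   bipyramid is a sum of two of these.  The row of the new edge of A' and B' is
   (-1, -1, -1, 0), and the other rows take their final form after adding to
   them the multiples of the first row by the entries of the first column of
   B'. *)

(** * Edges of the ideal simplex and their midpoints *)

(** A gluing step only permutes barycentric coordinates, so a condition on their values alone passes
    to glued points. On the simplex this condition singles out the midpoints of edges. *)
Lemma glued_halves (R : realType) (N : nat)
    (glue : 'I_N -> 'I_4 -> 'I_N * 'S_4) (p q : 'I_N * 'rV[R]_4) :
  glued glue p q ->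
  (forall i, p.2 0 i = 0 \/ p.2 0 i = 2^-1) <->
  (forall i, q.2 0 i = 0 \/ q.2 0 i = 2^-1).
Proof.
elim=> {p q} [p q [f [s [_ _ pq]]]|p|p q _ [pq qp]|p q r _ [pq qp] _ [qr rq]].
- split=> half i; last by rewrite -pq.
  by rewrite -(permKV s i) pq.
- by [].
- by split.
- by split=> [/pq/qr | /rq/qp].
Qed.

Lemma simplex_edge_pair (R : realType) (i j : 'I_4) (x : 'rV[R]_4) :
  i != j ->
  simplex_edge [set i; j]%SET x <->
  exists a : R, 0 < a < 1 /\
    forall m, x 0 m = if m == i then a else if m == j then 1 - a else 0.
Proof.
move=> nij; split=> [[[x01 sx] x0]|[a [/andP[a0 a1] xE]]].
  have x0' m : m != i -> m != j -> x 0 m = 0.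
    by move=> mi mj; apply: x0; rewrite !inE negb_or mi.
  have sij : x 0 i + x 0 j = 1.
    rewrite -sx (bigD1 i) //= (bigD1 j) ?[j == i]eq_sym //= big1 ?addr0 //.
    by move=> m /andP[]; apply: x0'.
  exists (x 0 i); split.
    have /andP[_ ->] := x01 i; rewrite andbT.
    (* Vertices are removed from the simplex: [x 0 j < 1] is the positivity of [x 0 i], since the
       two coordinates sum to 1. *)
    have /andP[_] := x01 j; rewrite -sij addrC.
    by rewrite -[X in X < _]addr0 ltrD2l.
  move=> m; case: eqVneq => [->//|mi]; case: eqVneq => [->|mj]; last exact: x0'.
  by rewrite -sij addrAC subrr add0r.
have x0 m : m \notin [set i; j]%SET -> x 0 m = 0.
  by rewrite !inE negb_or xE => /andP[/negPf-> /negPf->].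
split=> //; split=> [m|].
  rewrite xE; case: ifP => _; first by rewrite ltW.
  case: ifP => _; last by rewrite lexx ltr01.
  by rewrite subr_ge0 ltW //= gtrBl.
rewrite (bigD1 i) //= (bigD1 j) ?[j == i]eq_sym //= big1 => [|m /andP[mi mj]].
  by rewrite !xE eqxx [j == i]eq_sym (negPf nij) eqxx addr0 addrC subrK.
by rewrite x0 // !inE negb_or mi.
Qed.

(** * The covering group and translates of lifted edges *)

Lemma isometry_unit (R : realType) (g : 'M[R]_4) :
  oriented_isometry g -> g \is a GRing.unit.
Proof. by case=> _ _ dg; rewrite /GRing.unit /= unitmxE dg unitr1. Qed.

Lemma group_unit (R : realType) (Gam : set 'M[R]_4)
    (hGam : hyperbolic_group Gam) (g : 'M[R]_4) :
  Gam g -> g \is a GRing.unit.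
Proof. by move=> /(hyp_isometry hGam)/isometry_unit. Qed.

Lemma epimorphism1 (R : realType) (Gam : set 'M[R]_4)
    (al : 'M[R]_4 -> int) (hGam : hyperbolic_group Gam)
    (hal : epimorphism Gam al) :
  al 1 = 0.
Proof.
have [alM _] := hal; have G1 := hyp_one hGam.
by apply: (@addrI _ (al 1)); rewrite -alM // mulr1 addr0.
Qed.

Lemma epimorphismV (R : realType) (Gam : set 'M[R]_4)
    (al : 'M[R]_4 -> int) (hGam : hyperbolic_group Gam)
    (hal : epimorphism Gam al) (g : 'M[R]_4) :
  Gam g -> al g^-1 = - al g.
Proof.
have [alM _] := hal => Gg; have GV := hyp_inv hGam Gg.
apply: (@addrI _ (al g)); rewrite -alM // subrr divrr ?(group_unit hGam) //.
exact: (epimorphism1 hGam hal).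
Qed.

Lemma group_exprz (R : realType) (Gam : set 'M[R]_4)
    (hGam : hyperbolic_group Gam) (mu : 'M[R]_4) (k : int) :
  Gam mu -> Gam (mu ^ k).
Proof.
move=> Gmu; have GX n : Gam (mu ^+ n).
  elim: n => [|n IH]; first by rewrite expr0; exact: (hyp_one hGam).
  by rewrite exprS; exact: (hyp_mul hGam).
by case: k => n; [exact: GX | exact/(hyp_inv hGam)/GX].
Qed.

Lemma epimorphism_exprz (R : realType) (Gam : set 'M[R]_4)
    (al : 'M[R]_4 -> int) (hGam : hyperbolic_group Gam)
    (hal : epimorphism Gam al) (mu : 'M[R]_4) (k : int) :
  Gam mu -> al (mu ^ k) = al mu * k.
Proof.
move=> Gmu; have [alM _] := hal.
have alX n : al (mu ^+ n) = al mu * n%:Z.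
  elim: n => [|n IH]; first by rewrite expr0 mulr0 (epimorphism1 hGam hal).
  rewrite exprS alM // ?IH; last exact: (group_exprz hGam n).
  by rewrite intS mulrDr mulr1.
case: k => n; first exact: alX.
rewrite NegzE -exprnN (epimorphismV hGam hal) ?alX ?mulrN //.
exact: (group_exprz hGam n.+1).
Qed.

(* The midpoint of an edge is fixed by every self-gluing of the edge, so a deck
   transformation preserving the edge fixes its midpoint. *)
Lemma edge_in_inj (R : realType) (Gam : set 'M[R]_4)
    (al : 'M[R]_4 -> int) (hGam : hyperbolic_group Gam)
    (hal : epimorphism Gam al)
    (mu : 'M[R]_4) (Gmu : Gam mu) (almu : al mu = 1) (N : nat)
    (tet : 'I_N -> 'rV[R]_4 -> 'cV[R]_4) (htet : ideal_triangulation Gam tet)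
    (j : 'I_N) (s : {set 'I_4}) (k l : int) :
  #|s| = 2%N ->
  edge_in (cover_group Gam al) (mu ^ k) (tet j) s =
  edge_in (cover_group Gam al) (mu ^ l) (tet j) s -> k = l.
Proof.
move=> /eqP/cards2P[i [i' [nij ->]]] eqE.
have [glue [_ [tetc _ glueP _]]] := htet.
have [alM _] := hal.
pose m : 'rV[R]_4 := \row_r (if r \in [set i; i']%SET then 2^-1 else 0).
have h01 : 0 < (2^-1 : R) < 1 by rewrite invr_gt0 ltr0n invf_lt1 ?ltr1n ?ltr0n.
have hh : 1 - 2^-1 = 2^-1 :> R by rewrite {1}(splitr 1) mul1r addrK.
have em : simplex_edge [set i; i']%SET m.
  apply/simplex_edge_pair => //; exists 2^-1; split=> // r.
  by rewrite mxE !inE hh; do 2! case: eqP.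
have: edge_in (cover_group Gam al) (mu ^ k) (tet j) [set i; i']%SET
        (mu ^ k *m tet j m).
  exists 1, m; split; rewrite ?mul1mx //; split; first exact: (hyp_one hGam).
  exact: (epimorphism1 hGam hal).
rewrite eqE => -[h [y [[Gh alh] ey hy]]].
have Gk := group_exprz hGam k Gmu; have Gl := group_exprz hGam l Gmu.
have Ghl := hyp_mul hGam Gh Gl; have GV := hyp_inv hGam Ghl.
(* This element carries the image of the midpoint [m] to that of the point [y] of the same edge, so
   [m] and [y] are glued. *)
pose g := (h * mu ^ l)^-1 * mu ^ k.
have Gg : Gam g by exact: (hyp_mul hGam).
have gm : g *m tet j m = tet j y.
  rewrite /g -mulmxA hy [h *m _]mulmxA -[h *m _]/(h * _) mulmxA.
  by rewrite -[_ *m (h * _)]/(_ * _) mulVr ?mul1mx ?(group_unit hGam).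
have my : y = m.
  have /glued_halves[+ _] : glued glue (j, m) (j, y).
    by apply/glueP; [case: em | case: ey | exists g].
  move=> /= half; have {}half : forall r, y 0 r = 0 \/ y 0 r = 2^-1.
    by apply: half => r; rewrite mxE; case: ifP; [right | left].
  have [a [/andP[a0 a1] yE]] := (simplex_edge_pair y nij).1 ey.
  (* The other possible value, 0, would put [y] at a removed vertex. *)
  have a2 : a = 2^-1.
    have := half i; rewrite yE eqxx => -[a0'|//].
    by rewrite a0' ltxx in a0.
  by apply/rowP => r; rewrite yE mxE !inE a2 hh; do 2! case: eqP.
have g1 : g = 1.
  apply: (hyp_free hGam Gg (x := tet j m)); last by rewrite gm my.
  by have [_] := tetc j; apply; case: em.
(* As [g] is 1, [al g] vanishes; as [al h] is 0, it also equals k - l. *)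
have := epimorphism1 hGam hal.
rewrite -g1 /g alM // (epimorphismV hGam hal) // alM // alh.
rewrite !(epimorphism_exprz hGam hal) // almu !mul1r add0r => /eqP.
by rewrite addrC subr_eq0 => /eqP.
Qed.

(** The kernel of [al] is normal in [Gam]: conjugating by [g] moves [g] past the covering group,
    which gives the witnesses in both directions. *)
Lemma edge_in_translate (R : realType) (Gam : set 'M[R]_4)
    (al : 'M[R]_4 -> int) (hGam : hyperbolic_group Gam)
    (hal : epimorphism Gam al) (g f : 'M[R]_4)
    (tet : 'rV[R]_4 -> 'cV[R]_4) (s : {set 'I_4}) :
  Gam g ->
  edge_in (cover_group Gam al) (g * f) tet s =
  (mulmx g @` edge_in (cover_group Gam al) f tet s)%classic.
Proof.
move=> Gg; have [alM _] := hal.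
have gu := group_unit hGam Gg; have GV := hyp_inv hGam Gg.
have alV := epimorphismV hGam hal Gg.
rewrite predeqE => z; split=> [[h [x [[Gh alh] sx ->]]]|].
  exists ((g^-1 * h * g) *m (f *m tet x)); last first.
    by rewrite !mulmxA !mulmxE divrr // mul1r.
  have Gh' : Gam (g^-1 * h) by exact: (hyp_mul hGam).
  exists (g^-1 * h * g), x; split=> //; split; first exact: (hyp_mul hGam).
  by rewrite !alM // alh addr0 alV addNr.
move=> [_ [h [x [[Gh alh] sx ->]]] <-].
have Gh' : Gam (g * h) by exact: (hyp_mul hGam).
exists (g * h / g), x; split=> //.
  split; first exact: (hyp_mul hGam).
  by rewrite !alM // alh addr0 alV subrr.
by rewrite !mulmxA !mulmxE divrK.
Qed.

Lemma eq_edge_in (R : realType) (K : set 'M[R]_4) (g : 'M[R]_4)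
    (tet tet' : 'rV[R]_4 -> 'cV[R]_4) (s : {set 'I_4}) :
  (forall x, ideal_simplex x -> tet x = tet' x) ->
  edge_in K g tet s = edge_in K g tet' s.
Proof.
move=> eqt; rewrite predeqE => z.
by split=> -[h [x [Kh sx ->]]]; exists h, x; rewrite ?eqt //; case: sx.
Qed.

(** * Edges of the bipyramid as segments, and quad labels *)

Definition bip_segment (R : realType) (K : set 'M[R]_4)
    (Phi : 'rV[R]_3 -> 'cV[R]_4) (u v : bip_vertex) (g : 'M[R]_4) :
    set 'cV[R]_4 :=
  [set z | exists h a, [/\ K h, 0 < a < 1
    & z = h *m (g *m Phi (a *: bip_pos R u + (1 - a) *: bip_pos R v))]]%classic.

(** The map [tet] is [Phi] after an affine map, so its edge depends only on the two end vertices. An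
    edge seen in different tetrahedra thus becomes literally the same set. *)
Lemma edge_in_piece (R : realType) (K : set 'M[R]_4) (g : 'M[R]_4)
    (Phi : 'rV[R]_3 -> 'cV[R]_4) (tet : 'rV[R]_4 -> 'cV[R]_4)
    (nu : 'I_4 -> bip_vertex) (omit : bip_vertex) (i j : 'I_4) :
  bip_piece Phi tet nu omit -> i != j ->
  edge_in K g tet [set i; j]%SET = bip_segment K Phi (nu i) (nu j) g.
Proof.
move=> [_ _ tetE] nij.
have pos a (x : 'rV[R]_4) :
    (forall m, x 0 m = if m == i then a else if m == j then 1 - a else 0) ->
  \sum_m x 0 m *: bip_pos R (nu m) =
  a *: bip_pos R (nu i) + (1 - a) *: bip_pos R (nu j).
  move=> xE; rewrite (bigD1 i) //= (bigD1 j) ?[j == i]eq_sym //= big1.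
    by rewrite !xE eqxx [j == i]eq_sym (negPf nij) eqxx addr0.
  by move=> m /andP[/negPf mi /negPf mj]; rewrite xE mi mj scale0r.
rewrite predeqE => z; split=> [[h [x [Kh sx ->]]]|[h [a [Kh a01 ->]]]].
  have [a [a01 xE]] := (simplex_edge_pair x nij).1 sx.
  by exists h, a; split=> //; rewrite tetE ?(pos a) //; case: sx.
pose x : 'rV[R]_4 :=
  \row_m (if m == i then a else if m == j then 1 - a else 0).
have xE m : x 0 m = if m == i then a else if m == j then 1 - a else 0.
  by rewrite mxE.
have sx : simplex_edge [set i; j]%SET x.
  by apply/simplex_edge_pair => //; exists a.
by exists h, x; split=> //; rewrite tetE ?(pos a) //; case: sx.
Qed.

Lemma card_labelled (q p : 'I_3) (s : {set 'I_4}) :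
  s \in labelled q p -> #|s| = 2%N.
Proof.
have c2 (r : 'I_3) : #|[set ord0; lift ord0 r]%SET| = 2%N by rewrite cards2.
rewrite !inE => /orP[] /eqP->; first exact: c2.
by rewrite cardsCs finset.setCK c2 card_ord.
Qed.

Lemma labelledE (q p : 'I_3) (s s' : {set 'I_4}) :
  s \in labelled q p -> s' \in labelled q p -> s != s' ->
  labelled q p = [set s; s']%SET.
Proof.
rewrite /labelled /quad_edges !inE => /orP[] /eqP-> /orP[] /eqP->.
all: rewrite ?eqxx // => _; exact: finset.setUC.
Qed.

(** * Laurent polynomials counting translates of an edge *)

(** Additivity can fail for finite-support sums when a support is infinite; a finite set carrying
    both supports restores it. *)
Lemma fsbigD_supp (f g : int -> Qt) (D : set int) :
  finite_set D ->
  (forall k, ~ D k -> f k = 0) -> (forall k, ~ D k -> g k = 0) ->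
  \sum_(k \in [set: int]) (f k + g k) =
  \sum_(k \in [set: int]) f k + \sum_(k \in [set: int]) g k.
Proof.
move=> finD f0 g0; have wid (h : int -> Qt) : (forall k, ~ D k -> h k = 0) ->
    \sum_(k \in [set: int]) h k = \sum_(k \in D) h k.
  by move=> h0; rewrite -(fsbig_widen D setT) // => k [_ /h0].
rewrite !wid // => [|k Dk]; last by rewrite f0 // g0 // addr0.
exact: fsbig_split.
Qed.

(** The contribution of one edge of a tetrahedron to a gluing entry, [E k] being its translate by
    [mu ^ k]. When [E] is injective it is 0 or a single power of t. *)
Definition edge_series (X : Type) (E : int -> X) (e : X) : Qt :=
  \sum_(k \in [set: int]) `[< E k = e >]%:R * laurent_t ^ k.

Lemma edge_series0 (X : Type) (E : int -> X) (e : X) :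
  (forall k, E k <> e) -> edge_series E e = 0.
Proof. by move=> nE; apply: fsbig1 => k _; rewrite asboolF ?mul0r. Qed.

Lemma edge_series1 (X : Type) (E : int -> X) (e : X) :
  injective E -> E 0 = e -> edge_series E e = 1.
Proof.
move=> Einj E0; rewrite /edge_series -(fsbig_widen [set 0%Z]%classic setT) //.
  by rewrite fsbig_set1 asboolT // expr0z mulr1.
by move=> k [_ /= k0]; rewrite asboolF ?mul0r // -E0 => /Einj.
Qed.

(* A sum over all of Z with infinite support is 0 by convention; injectivity
   makes the supports finite. *)
Lemma edge_seriesD (X : Type) (E E' : int -> X) (e : X) :
  injective E -> injective E' ->
  \sum_(k \in [set: int])
    (`[< E k = e >] + `[< E' k = e >])%N%:R * laurent_t ^ k =
  edge_series E e + edge_series E' e.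
Proof.
move=> Einj E'inj.
have fin (F : int -> X) : injective F -> finite_set [set k | F k = e]%classic.
  move=> Finj; have [[k Fk]|nF] := pselect (exists k, F k = e).
    apply: sub_finite_set (finite_set1 k) => l /= Fl.
    by apply: Finj; rewrite Fk.
  by apply: sub_finite_set (finite_set0 _) => l /= Fl; apply: nF; exists l.
rewrite -(@fsbigD_supp _ _ ([set k | E k = e] `|` [set k | E' k = e])%classic).
- by apply: eq_fsbigr => k _; rewrite natrD mulrDl.
- by rewrite finite_setU; split; exact: fin.
- by move=> k /= /not_orP[nE _]; rewrite asboolF ?mul0r.
- by move=> k /= /not_orP[_ nE]; rewrite asboolF ?mul0r.
Qed.

(** A label is carried by exactly two opposite edges. The inequalities between vertices make the two
    given edges distinct, so they are all the edges to count, and each contributes its own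
    series. *)
Lemma twisted_gluing_piece (R : realType) (Gam : set 'M[R]_4)
    (al : 'M[R]_4 -> int) (hGam : hyperbolic_group Gam)
    (hal : epimorphism Gam al) (mu : 'M[R]_4) (Gmu : Gam mu) (almu : al mu = 1)
    (N : nat) (T : nz_data R N) (hT : ideal_triangulation Gam (nz_tet T))
    (Phi : 'rV[R]_3 -> 'cV[R]_4) (nu : 'I_4 -> bip_vertex)
    (omit u v u' v' : bip_vertex) (p : 'I_3) (i j : 'I_N) :
  let S x y k := bip_segment (cover_group Gam al) Phi x y (mu ^ k) in
  bip_piece Phi (nz_tet T j) nu omit ->
  bip_label nu (nz_quad T j) p u v -> bip_label nu (nz_quad T j) p u' v' ->
  u <> v -> u' <> v' -> u <> u' -> u <> v' ->
  twisted_gluing Gam al mu T p i j =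
  edge_series (S u v) (nz_edge T i) + edge_series (S u' v') (nz_edge T i).
Proof.
move=> S piece [x [y [ux vy lxy]]] [x' [y' [ux' vy' lxy']]] nuv nuv' nuu' nuv''.
have neq (a b : 'I_4) : nu a <> nu b -> a != b.
  by move=> nab; apply/eqP => ab; apply: nab; rewrite ab.
have nxy : x != y by apply: neq; rewrite ux vy.
have nxy' : x' != y' by apply: neq; rewrite ux' vy'.
have SE k : S u v k =
    edge_in (cover_group Gam al) (mu ^ k) (nz_tet T j) [set x; y]%SET.
  by rewrite (edge_in_piece _ _ piece) // ux vy.
have SE' k : S u' v' k =
    edge_in (cover_group Gam al) (mu ^ k) (nz_tet T j) [set x'; y']%SET.
  by rewrite (edge_in_piece _ _ piece) // ux' vy'.
rewrite mxE -edge_seriesD.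
- apply: eq_fsbigr => k _; congr (_%:R * _); rewrite /gluing_coef.
  (* The vertex [x] is in the first edge only, because [u] is neither [u'] nor [v']. *)
  have nss : [set x; y]%SET != [set x'; y']%SET.
    apply/eqP => /setP/(_ x); rewrite !inE eqxx /= => /esym/orP[] /eqP xx.
      by apply: nuu'; rewrite -ux -ux' xx.
    by apply: nuv''; rewrite -ux -vy' xx.
  rewrite -sum1dep_card (labelledE lxy lxy' nss) big_mkcondr /=.
  by rewrite big_setU1 ?inE //= big_set1 -SE -SE'; do 2! case: asboolP.
- move=> k l; rewrite !SE; apply: (edge_in_inj hGam hal Gmu almu hT).
  by rewrite cards2 nxy.
- move=> k l; rewrite !SE'; apply: (edge_in_inj hGam hal Gmu almu hT).
  by rewrite cards2 nxy'.
Qed.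

(** * Laurent polynomial entries *)

Lemma is_laurentD f g : is_laurent f -> is_laurent g -> is_laurent (f + g).
Proof.
have tX m : laurent_t ^+ m != 0.
  by rewrite expf_neq0 // /laurent_t tofrac_eq0 polyX_eq0.
move=> [p [m ->]] [q [l ->]]; exists (p * 'X^l + q * 'X^m), (m + l)%N.
rewrite addf_div; [|exact: tX|exact: tX].
by rewrite exprD tofracD !tofracM !tofracXn.
Qed.

Lemma is_laurentN f : is_laurent f -> is_laurent (- f).
Proof. by move=> [p [m ->]]; exists (- p), m; rewrite tofracN mulNr. Qed.

Lemma is_laurent_nat_exp (m : nat) (k : int) :
  is_laurent (m%:R * laurent_t ^ k).
Proof.
case: k => k.
  exists (m%:R * 'X^k), 0%N.
  by rewrite divr1 tofracM tofracXn tofracMn tofrac1.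
(* The negative case is the exponent -(k+1), hence the denominator of degree [k.+1]. *)
by exists m%:R, k.+1; rewrite tofracMn tofrac1.
Qed.

Lemma is_laurent0 : is_laurent 0.
Proof. by exists 0, 0%N; rewrite tofrac0 mul0r. Qed.

(** A finite-support sum is always a finite sum, being empty for an infinite support, so closure
    under addition suffices. *)
Lemma is_laurent_twisted_gluing (R : realType) (Gam : set 'M[R]_4)
    (al : 'M[R]_4 -> int) (mu : 'M[R]_4) (N : nat) (T : nz_data R N)
    (p : 'I_3) (i j : 'I_N) :
  is_laurent (twisted_gluing Gam al mu T p i j).
Proof.
rewrite mxE; apply: (big_ind is_laurent) => [||k _].
- exact: is_laurent0.
- exact: is_laurentD.
- exact: is_laurent_nat_exp.
Qed.

Lemma twisted_AE (R : realType) (Gam : set 'M[R]_4) (al : 'M[R]_4 -> int)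
    (mu : 'M[R]_4) (N : nat) (T : nz_data R N) (i j : 'I_N) :
  twisted_A Gam al mu T i j =
  twisted_gluing Gam al mu T 0 i j - twisted_gluing Gam al mu T 1 i j.
Proof. by rewrite /twisted_A mxE [X in _ + X]mxE. Qed.

Lemma twisted_BE (R : realType) (Gam : set 'M[R]_4) (al : 'M[R]_4 -> int)
    (mu : 'M[R]_4) (N : nat) (T : nz_data R N) (i j : 'I_N) :
  twisted_B Gam al mu T i j =
  twisted_gluing Gam al mu T 2 i j - twisted_gluing Gam al mu T 1 i j.
Proof. by rewrite /twisted_B mxE [X in _ + X]mxE. Qed.

(** * The new edge and the common tetrahedra under the move *)

(** An edge of an old tetrahedron is a translate of some lifted edge of [T], which has index
    [lift ord0 i] in [T']. Were it also the new edge, the indices 0 and [lift ord0 i] would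
    represent the same edge of M, against uniqueness in [T']. *)
Lemma edge_in_new (R : realType) (Gam : set 'M[R]_4)
    (al : 'M[R]_4 -> int) (hGam : hyperbolic_group Gam)
    (hal : epimorphism Gam al) (mu : 'M[R]_4) (Gmu : Gam mu) (n : nat)
    (T : nz_data R (2 + n)) (T' : nz_data R (3 + n))
    (hT : nz_valid Gam al T) (hT' : nz_valid Gam al T')
    (hTT' : pachner23 Gam al T T')
    (j : 'I_(2 + n)) (s : {set 'I_4}) (k : int) :
  #|s| = 2%N ->
  edge_in (cover_group Gam al) (mu ^ k) (nz_tet T j) s <> nz_edge T' 0.
Proof.
move=> s2 eq0.
have [i [[g Gg iE] _]] := nz_edge_unique hT j s2.
have [g0 [j0 [s0 [Gg0 s02 E0]]]] := nz_edge_lift hT' 0.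
have [i0 [_ uniq0]] := nz_edge_unique hT' j0 s02.
have Gk := group_exprz hGam k Gmu; have GkV := hyp_inv hGam Gk.
have Gf : Gam (g / mu ^ k) by exact: (hyp_mul hGam).
have EL : nz_edge T' (lift ord0 i) =
    edge_in (cover_group Gam al) (g / mu ^ k * g0) (nz_tet T' j0) s0.
  rewrite (p23_common_edge hTT') iE.
  rewrite (edge_in_translate hGam hal _ _ _ Gf) -E0 -eq0.
  by rewrite -(edge_in_translate hGam hal _ _ _ Gf) divrK ?(group_unit hGam).
have i00 : i0 = 0 by apply: uniq0; exists g0.
have : i0 = lift ord0 i.
  by apply: uniq0; exists (g / mu ^ k * g0) => //; exact: (hyp_mul hGam).
by rewrite i00 => /(congr1 val).
Qed.

Lemma twisted_gluing_common (R : realType) (Gam : set 'M[R]_4)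
    (al : 'M[R]_4 -> int) (hGam : hyperbolic_group Gam)
    (hal : epimorphism Gam al) (mu : 'M[R]_4) (Gmu : Gam mu) (n : nat)
    (T : nz_data R (2 + n)) (T' : nz_data R (3 + n))
    (hT : nz_valid Gam al T) (hT' : nz_valid Gam al T')
    (hTT' : pachner23 Gam al T T')
    (p : 'I_3) (j : 'I_n) :
  twisted_gluing Gam al mu T' p 0 (rshift 3 j) = 0 /\
  forall i, twisted_gluing Gam al mu T' p (lift ord0 i) (rshift 3 j) =
            twisted_gluing Gam al mu T p i (rshift 2 j).
Proof.
have eqE k s := eq_edge_in (cover_group Gam al) (mu ^ k) s
  (@p23_common_tet _ _ _ _ _ _ hTT' j).
split=> [|i]; rewrite mxE.
  apply: fsbig1 => k _; rewrite /gluing_coef eq_card0 ?mul0r // => s.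
  rewrite [LHS]inE [RHS]inE (p23_common_quad hTT').
  apply/negbTE/andP => -[/card_labelled s2].
  by rewrite eqE => /asboolP; exact: (edge_in_new hGam hal Gmu hT hT' hTT').
rewrite [RHS]mxE; apply: eq_fsbigr => k _; congr (_%:R * _).
apply: eq_card => s; rewrite !inE (p23_common_quad hTT').
by rewrite (p23_common_edge hTT') eqE.
Qed.

(** All translates of the new edge lie over one edge of M, whose unique index in [T'] is 0. *)
Lemma edge_in_old (R : realType) (Gam : set 'M[R]_4)
    (al : 'M[R]_4 -> int) (hGam : hyperbolic_group Gam) (mu : 'M[R]_4)
    (Gmu : Gam mu) (n : nat) (T' : nz_data R (3 + n))
    (hT' : nz_valid Gam al T') (j : 'I_(3 + n)) (s : {set 'I_4}) (k : int)
    (i : 'I_(2 + n)) :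
  #|s| = 2%N -> nz_edge T' 0 = edge_in (cover_group Gam al) 1 (nz_tet T' j) s ->
  edge_in (cover_group Gam al) (mu ^ k) (nz_tet T' j) s <>
  nz_edge T' (lift ord0 i).
Proof.
move=> s2 E0 EL; have [i0 [_ uniq0]] := nz_edge_unique hT' j s2.
have i00 : i0 = 0 by apply: uniq0; exists 1 => //; exact: (hyp_one hGam).
have : i0 = lift ord0 i.
  by apply: uniq0; exists (mu ^ k) => //; exact: (group_exprz hGam).
by rewrite i00 => /(congr1 val).
Qed.

(** * The matrix adding multiples of the first row to the others *)

Lemma add_row0_is_trig (F : fieldType) (m : nat) (x : 'cV[F]_m) :
  is_trig_mx (block_mx (1 : 'M[F]_1) 0 x 1%:M).
Proof. by rewrite is_trig_block_mx // eqxx !scalar_mx_is_trig. Qed.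

Lemma add_row0_diag (F : fieldType) (m : nat) (x : 'cV[F]_m) i :
  block_mx (1 : 'M[F]_1) 0 x 1%:M i i = 1.
Proof.
rewrite -(splitK i); case: (fintype.split i) => i' /=.
  by rewrite block_mxEul mxE eqxx.
by rewrite block_mxEdr mxE eqxx.
Qed.

Lemma add_row0_entry (F : fieldType) (m : nat) (x : 'cV[F]_m) i j :
  block_mx (1 : 'M[F]_1) 0 x 1%:M i j = (i == j)%:R \/
  exists i', block_mx (1 : 'M[F]_1) 0 x 1%:M i j = x i' 0.
Proof.
rewrite -(splitK i); case: (fintype.split i) => i' /=.
  rewrite -(splitK j); case: (fintype.split j) => j' /=; left.
    by rewrite block_mxEul mxE (inj_eq (@lshift_inj _ _)).
  by rewrite block_mxEur mxE eq_lrshift.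
rewrite -(splitK j); case: (fintype.split j) => j' /=.
  by right; exists i'; rewrite block_mxEdl (ord1 j').
by left; rewrite block_mxEdr mxE (inj_eq (@rshift_inj _ _)).
Qed.

(** The hypotheses say that the lower block of [M] is [Q - x *m r], and the block product adds
    [x *m r] back. *)
Lemma add_row0_mul (F : fieldType) (m q : nat) (x : 'cV[F]_m)
    (M : 'M[F]_(1 + m, q)) (r : 'rV[F]_q) (Q : 'M[F]_(m, q)) :
  (forall j, M ord0 j = r 0 j) ->
  (forall i j, M (lift ord0 i) j + x i 0 * r 0 j = Q i j) ->
  block_mx 1 0 x 1%:M *m M = col_mx r Q.
Proof.
move=> Mr MQ.
have -> : M = col_mx r (Q - x *m r).
  apply/matrixP => i j; rewrite -(splitK i); case: (fintype.split i) => i' /=.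
    by rewrite col_mxEu (ord1 i') -Mr; congr (M _ j); apply: val_inj.
  rewrite col_mxEd !mxE big_ord1 -MQ addrK; congr (M _ j); exact: val_inj.
rewrite mul_block_col mul1mx mul0mx addr0 mul1mx.
by rewrite addrC subrK.
Qed.

(** * Block column indices and the column identities *)

(** Nested [row_mx] blocks address the first three columns by shifts, whereas the move numbers the
    new tetrahedra by ring numerals; this lemma and the next two translate. *)
Lemma ord3D_0 (n : nat) :
  lshift n (lshift 1 (lshift 1 (ord0 : 'I_1))) = (0 : 'I_(3 + n)).
Proof. exact: val_inj. Qed.

Lemma ord3D_1 (n : nat) :
  lshift n (lshift 1 (rshift 1 (ord0 : 'I_1))) = (1 : 'I_(3 + n)).
Proof. exact: val_inj. Qed.

Lemma ord3D_2 (n : nat) :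
  lshift n (rshift 2 (ord0 : 'I_1)) = (2 : 'I_(3 + n)).
Proof. exact: val_inj. Qed.

Lemma ord3D_ind (n : nat) (Q : 'I_(3 + n) -> Prop) : Q 0 -> Q 1 -> Q 2 ->
    (forall j : 'I_n, Q (rshift 3 j)) -> forall j, Q j.
Proof.
rewrite -ord3D_2 -ord3D_1 -ord3D_0 => Q0 Q1 Q2 Qr j.
rewrite -(splitK j); case: (fintype.split j) => j' /=; last exact: Qr.
case: j' => [[|[|[|//]]] lt_j].
- by move: Q0; congr (Q _); apply: val_inj.
- by move: Q1; congr (Q _); apply: val_inj.
- by move: Q2; congr (Q _); apply: val_inj.
Qed.

Lemma row_mx3E (X : Type) (m n : nat) (u v w : 'cV[X]_m)
    (U : 'M[X]_(m, n)) (i : 'I_m) :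
  let W : 'M[X]_(m, 3 + n) :=
    row_mx (row_mx (row_mx u v) w : 'M[X]_(m, 3)) U in
  [/\ W i 0 = u i 0, W i 1 = v i 0, W i 2 = w i 0
    & forall j, W i (rshift 3 j) = U i j].
Proof.
move=> W; rewrite -ord3D_2 -ord3D_1 -ord3D_0; split=> [|||j].
- by rewrite /W row_mxEl (row_mxEl (row_mx u v)) row_mxEl.
- by rewrite /W row_mxEl (row_mxEl (row_mx u v)) row_mxEr.
- by rewrite /W row_mxEl (row_mxEr (row_mx u v)).
- by rewrite /W row_mxEr.
Qed.

Lemma row_const_mxE (F : nmodType) (n : nat) (a : F) :
  let W : 'rV[F]_(3 + n) := row_mx (const_mx a : 'rV[F]_3) 0 in
  [/\ W 0 0 = a, W 0 1 = a, W 0 2 = a & forall j, W 0 (rshift 3 j) = 0].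
Proof.
move=> W; rewrite -ord3D_2 -ord3D_1 -ord3D_0; split=> [|||j].
1-3: by rewrite /W row_mxEl mxE.
by rewrite /W row_mxEr mxE.
Qed.

(* The columns of the reduced matrices: n_i, s_i are the series of the edges
   from the apexes n, s to the vertex v_i of the common face, and f_i is that
   of the edge of this face opposite to v_i. *)
Lemma pachner_columns (F : comPzRingType) (n1 n2 n3 s1 s2 s3 f1 f2 f3 : F) :
  let x := n2 + s3 - f1 in
  [/\ [/\ n3 + s2 - f1 + x * -1 = n3 + f3 - (n2 + f2) + (s2 + f2 - (s3 + f3)),
          n1 + s3 - f2 + x * -1 = n1 + f1 - (n2 + f2)
        & n2 + s1 - f3 + x * -1 = s1 + f1 - (s3 + f3)]
    & [/\ n2 + s3 - f1 + x * -1 = 0,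
          n3 + s1 - f2 + x * -1 = s1 + f1 - (s3 + f3) + (n3 + f3 - (n2 + f2))
        & n1 + s2 - f3 + x * -1 = n1 + f1 - (n2 + f2) + (s2 + f2 - (s3 + f3))]].
Proof. by move=> x; rewrite /x; split; split; ring. Qed.

(** * Reduction of the twisted matrices *)

Theorem theorem1p4 (R : realType) (Gam : set 'M[R]_4)
    (hGam : one_cusped_hyperbolic Gam)
    (al : 'M[R]_4 -> int) (hal : epimorphism Gam al)
    (mu : 'M[R]_4) (hmu : peripheral_curve Gam mu) (halmu : al mu = 1)
    (n : nat) (T : nz_data R (2 + n)) (T' : nz_data R (3 + n))
    (hT : nz_valid Gam al T) (hT' : nz_valid Gam al T')
    (hTT' : pachner23 Gam al T T') :
  let A : 'M[Qt]_(2 + n) := twisted_A Gam al mu T in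
  let B : 'M[Qt]_(2 + n) := twisted_B Gam al mu T in
  let a1 := col (lshift n 0) A in
  let a2 := col (lshift n 1) A in
  let a := rsubmx A in
  let b1 := col (lshift n 0) B in
  let b2 := col (lshift n 1) B in
  let b := rsubmx B in
  exists P : 'M[Qt]_(3 + n),
    [/\ is_trig_mx P,
        forall i, P i i = 1,
        forall i j, is_laurent (P i j),
        P *m twisted_A Gam al mu T' =
          (col_mx (row_mx (const_mx (-1) : 'rV_3) 0)
             (row_mx (row_mx (row_mx (b1 + b2) a1) a2 : 'M[Qt]_(2 + n, 3)) a)
           : 'M[Qt]_(1 + (2 + n), 3 + n))
      & P *m twisted_B Gam al mu T' =
          (col_mx (row_mx (const_mx (-1) : 'rV_3) 0)
             (row_mx (row_mx (row_mx (0 : 'cV_(2 + n)) (a2 + b1)) (a1 + b2)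
                      : 'M[Qt]_(2 + n, 3)) b)
           : 'M[Qt]_(1 + (2 + n), 3 + n))].
Proof.
move=> A B a1 a2 a b1 b2 b.
have hG := och_group hGam.
have Gmu : Gam mu by case: hmu => [? [? [_ _ [] //]]].
have [Phi [nual [nube [nua [nub [nuc]]]]]] := p23_bipyramid hTT'.
move=> /= [[pal pbe pa pb pc] E0 [a_ns b_ns c_ns]
  [[al_23 be_23 a_23] [al_13 be_13 b_13] [al_12 be_12 c_12]]
  [[[al_n1 b_n1 c_n1] [al_n2 a_n2 c_n2] [al_n3 a_n3 b_n3]]
   [[be_s1 b_s1 c_s1] [be_s3 a_s3 b_s3] [be_s2 a_s2 c_s2]]]].
pose S u v (k : int) := bip_segment (cover_group Gam al) Phi u v (mu ^ k).
pose c u v i := edge_series (S u v) (nz_edge T' i).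
pose G p i j := twisted_gluing Gam al mu T p i j.
pose G' p i j := twisted_gluing Gam al mu T' p i j.
have AE i j : A i j = G 0 i j - G 1 i j := twisted_AE _ _ _ _ _ _.
have BE i j : B i j = G 2 i j - G 1 i j := twisted_BE _ _ _ _ _ _.
have AE' i j : twisted_A Gam al mu T' i j = G' 0 i j - G' 1 i j.
  exact: twisted_AE.
have BE' i j : twisted_B Gam al mu T' i j = G' 2 i j - G' 1 i j.
  exact: twisted_BE.
(* Common edges keep their lifts, so row [i] of [T] is read off in row [lift ord0 i] of [T'], and
   the same series [c] serve both triangulations. *)
have GT j nu o (p : 'I_3) u v u' v' i : bip_piece Phi (nz_tet T j) nu o ->
    bip_label nu (nz_quad T j) p u v -> bip_label nu (nz_quad T j) p u' v' ->
    u <> v -> u' <> v' -> u <> u' -> u <> v' ->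
    G p i j = c u v (lift ord0 i) + c u' v' (lift ord0 i).
  rewrite /c (p23_common_edge hTT'); move: i j.
  exact: (twisted_gluing_piece hG hal Gmu halmu (nz_triangulation hT)).
have GT' j nu o (p : 'I_3) u v u' v' i : bip_piece Phi (nz_tet T' j) nu o ->
    bip_label nu (nz_quad T' j) p u v -> bip_label nu (nz_quad T' j) p u' v' ->
    u <> v -> u' <> v' -> u <> u' -> u <> v' ->
    G' p i j = c u v i + c u' v' i.
  exact: (twisted_gluing_piece hG hal Gmu halmu (nz_triangulation hT')).
(* Every boundary edge of the bipyramid belongs to an old tetrahedron, so its series vanishes in the
   row of the new edge. *)
have old j nu o q p u v : bip_piece Phi (nz_tet T j) nu o ->
    bip_label nu q p u v -> u <> v -> c u v ord0 = 0.
  move=> piece [x [y [xu yv _]]] uv; apply: edge_series0 => k.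
  have nxy : x != y by apply/eqP => xy; apply: uv; rewrite -xu -yv xy.
  rewrite /S -xu -yv -(edge_in_piece _ _ piece) //.
  by apply: (edge_in_new hG hal Gmu hT hT' hTT'); rewrite cards2 nxy.
(* The segment between the apexes is the chosen lift of the new edge: its series is 1 in the first
   row and 0 in the others. *)
have [x0 [y0 [x0n y0s _]]] := a_ns.
have nxy0 : x0 != y0 by apply/eqP => xy; move: y0s; rewrite -xy x0n.
have nsE k : S bip_n bip_s k =
    edge_in (cover_group Gam al) (mu ^ k) (nz_tet T' 0) [set x0; y0]%SET.
  by rewrite (edge_in_piece _ _ pa) // x0n y0s.
have ns1 : c bip_n bip_s ord0 = 1.
  apply: edge_series1 => [k l|]; last by rewrite nsE expr0z -E0.
  rewrite !nsE; apply: (edge_in_inj hG hal Gmu halmu (nz_triangulation hT')).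
  by rewrite cards2 nxy0.
have ns0 i : c bip_n bip_s (lift ord0 i) = 0.
  apply: edge_series0 => k; rewrite nsE.
  by apply: (edge_in_old hG Gmu hT'); rewrite ?cards2 ?nxy0 //; apply: E0.
have z_n1 : c bip_n bip_v1 ord0 = 0 by exact: old pal al_n1 _.
have z_n2 : c bip_n bip_v2 ord0 = 0 by exact: old pal al_n2 _.
have z_n3 : c bip_n bip_v3 ord0 = 0 by exact: old pal al_n3 _.
have z_s1 : c bip_s bip_v1 ord0 = 0 by exact: old pbe be_s1 _.
have z_s2 : c bip_s bip_v2 ord0 = 0 by exact: old pbe be_s2 _.
have z_s3 : c bip_s bip_v3 ord0 = 0 by exact: old pbe be_s3 _.
have z_23 : c bip_v2 bip_v3 ord0 = 0 by exact: old pal al_23 _.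
have z_13 : c bip_v1 bip_v3 ord0 = 0 by exact: old pal al_13 _.
have z_12 : c bip_v1 bip_v2 ord0 = 0 by exact: old pal al_12 _.
have row0 := (z_n1, z_n2, z_n3, z_s1, z_s2, z_s3, z_23, z_13, z_12, ns1,
              add0r, addr0, sub0r).
have comE p i (j : 'I_n) : G' p (lift ord0 i) (rshift 3 j) = G p i (rshift 2 j).
  rewrite /G' /G.
  by have [_ ->] := twisted_gluing_common hG hal Gmu hT hT' hTT' p j.
have com0 p (j : 'I_n) : G' p ord0 (rshift 3 j) = 0.
  by have [] := twisted_gluing_common hG hal Gmu hT hT' hTT' p j.
(* In each of these tuples the components follow the labels z, z', z'', each with its pair of
   opposite edges. *)
have G_al i := (GT _ _ _ _ _ _ _ _ i pal al_n1 al_23,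
  GT _ _ _ _ _ _ _ _ i pal al_n2 al_13, GT _ _ _ _ _ _ _ _ i pal al_n3 al_12).
have G_be i := (GT _ _ _ _ _ _ _ _ i pbe be_s1 be_23,
  GT _ _ _ _ _ _ _ _ i pbe be_s3 be_12, GT _ _ _ _ _ _ _ _ i pbe be_s2 be_13).
have G_a i := (GT' _ _ _ _ _ _ _ _ i pa a_n3 a_s2,
  GT' _ _ _ _ _ _ _ _ i pa a_ns a_23, GT' _ _ _ _ _ _ _ _ i pa a_n2 a_s3).
have G_b i := (GT' _ _ _ _ _ _ _ _ i pb b_n1 b_s3,
  GT' _ _ _ _ _ _ _ _ i pb b_ns b_13, GT' _ _ _ _ _ _ _ _ i pb b_n3 b_s1).
have G_c i := (GT' _ _ _ _ _ _ _ _ i pc c_n2 c_s1,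
  GT' _ _ _ _ _ _ _ _ i pc c_ns c_12, GT' _ _ _ _ _ _ _ _ i pc c_n1 c_s2).
have l0 : lshift n 0 = (0 : 'I_(2 + n)) by exact: val_inj.
have l1 : lshift n 1 = (1 : 'I_(2 + n)) by exact: val_inj.
have a1E i : a1 i 0 = A i 0 by rewrite mxE l0.
have a2E i : a2 i 0 = A i 1 by rewrite mxE l1.
have b1E i : b1 i 0 = B i 0 by rewrite mxE l0.
have b2E i : b2 i 0 = B i 1 by rewrite mxE l1.
(* These multipliers are forced: the first row has -1 in column 0, and the target for B' has 0 below
   it. *)
pose x : 'cV[Qt]_(2 + n) := \col_i twisted_B Gam al mu T' (lift ord0 i) 0.
have xE i : x i 0 = c bip_n bip_v2 (lift ord0 i) + c bip_s bip_v3 (lift ord0 i)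
    - c bip_v2 bip_v3 (lift ord0 i).
  by rewrite mxE BE' !G_a // ns0 add0r.
have cols i := pachner_columns
  (c bip_n bip_v1 (lift ord0 i)) (c bip_n bip_v2 (lift ord0 i))
  (c bip_n bip_v3 (lift ord0 i)) (c bip_s bip_v1 (lift ord0 i))
  (c bip_s bip_v2 (lift ord0 i)) (c bip_s bip_v3 (lift ord0 i))
  (c bip_v2 bip_v3 (lift ord0 i)) (c bip_v1 bip_v3 (lift ord0 i))
  (c bip_v1 bip_v2 (lift ord0 i)).
have [r0 r1 r2 rr] := @row_const_mxE Qt n (-1).
exists (block_mx 1 0 x 1%:M : 'M[Qt]_(1 + (2 + n))); split.
- exact: add_row0_is_trig.
- exact: add_row0_diag.
- move=> i j; have [->|[i' ->]] := add_row0_entry x i j.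
    case: (i == j); last exact: is_laurent0.
    by exists 1, 0%N; rewrite tofrac1 divr1.
  rewrite mxE twisted_BE.
  apply: is_laurentD; first exact: is_laurent_twisted_gluing.
  exact/is_laurentN/is_laurent_twisted_gluing.
- apply: add_row0_mul => [|i].
    (* In the first row only the apex segment counts. It has label z' in each new tetrahedron, and
       z' enters A' with a minus sign, hence -1. *)
    elim/ord3D_ind => [|||j]; rewrite AE'.
    + by rewrite !G_a // r0 !row0.
    + by rewrite !G_b // r1 !row0.
    + by rewrite !G_c // r2 !row0.
    + by rewrite !com0 rr subr0.
  (* Below the first row [ns0] removes the apex segment, and each bipyramid column is an identity of
     [pachner_columns]. The first row is 0 in the common columns, which therefore do not change. *)
  have [R0 R1 R2 Rr] := row_mx3E (b1 + b2) a1 a2 a i.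
  have [[A0 A1 A2] _] := cols i.
  elim/ord3D_ind => [|||j]; rewrite AE' xE.
  + by rewrite R0 r0 [RHS]mxE b1E b2E !BE !G_a // !G_al // !G_be // ns0 add0r.
  + by rewrite R1 r1 a1E AE !G_b // !G_al // ns0 add0r.
  + by rewrite R2 r2 a2E AE !G_c // !G_be // ns0 add0r.
  + by rewrite Rr rr mulr0 addr0 !comE mxE AE.
- apply: add_row0_mul => [|i].
    elim/ord3D_ind => [|||j]; rewrite BE'.
    + by rewrite !G_a // r0 !row0.
    + by rewrite !G_b // r1 !row0.
    + by rewrite !G_c // r2 !row0.
    + by rewrite !com0 rr subr0.
  have [R0 R1 R2 Rr] := row_mx3E 0 (a2 + b1) (a1 + b2) b i.
  have [_ [B0 B1 B2]] := cols i.
  elim/ord3D_ind => [|||j]; rewrite BE' xE.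
  + by rewrite R0 r0 [RHS]mxE !G_a // ns0 add0r.
  + by rewrite R1 r1 [RHS]mxE a2E b1E AE BE !G_b // !G_al // !G_be // ns0 add0r.
  + by rewrite R2 r2 [RHS]mxE a1E b2E AE BE !G_c // !G_al // !G_be // ns0 add0r.
  + by rewrite Rr rr mulr0 addr0 !comE mxE BE.
Qed.
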